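(* Let $n\ge1$ and let $X$ be a finite switch. The switch braid quiver polynomial $\Phi_X^{C}$ is an invariant of braids; that is, if $B$ and $B'$ are $n$-strand braid diagrams related by a finite sequence of braid Reidemeister moves, then $\Phi_X^{C}(B)=\Phi_X^{C}(B')$.
   Context: A switch is a set $X$ with an invertible map $\rho=(\rho_1,\rho_2):X\times X\to X\times X$ satisfying the set-theoretic Yang-Baxter equation $(\rho\times\mathrm{Id}_X)(\mathrm{Id}_X\times\rho)(\rho\times\mathrm{Id}_X)=(\mathrm{Id}_X\times\rho)(\rho\times\mathrm{Id}_X)(\mathrm{Id}_X\times\rho)$. An $n$-strand braid diagram $B$ is (up to planar isotopy) a word in $\sigma_1^{\pm1},\dots,\sigma_{n-1}^{\pm1}$ read from top to bottom, where $\sigma_i$ denotes a positive crossing of the strands in positions $i,i+1$; planar isotopy allows $\sigma_i^{\pm1}\sigma_j^{\pm1}=\sigma_j^{\pm1}\sigma_i^{\pm1}$ (any signs) for $|i-j|\ge2$. The braid Reidemeister moves are the direct Reidemeister II moves (inserting or deleting $\sigma_i\sigma_i^{-1}$ or $\sigma_i^{-1}\sigma_i$) and the Reidemeister III moves ($\sigma_i\sigma_{i+1}\sigma_i\leftrightarrow\sigma_{i+1}\sigma_i\sigma_{i+1}$ and its variants with other crossing signs). The map $\varphi_B:X^n\to X^n$ sends a vector of colors at the top of $B$ to the vector of colors induced at the bottom: $\varphi_{\sigma_i}$ replaces $(x_i,x_{i+1})$ by $\rho(x_i,x_{i+1})$ and fixes the other coordinates, $\varphi_{\sigma_i^{-1}}$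 does the same with $\rho^{-1}$, and $\varphi_{B_1B_2}=\varphi_{B_2}\circ\varphi_{B_1}$ for the concatenation $B_1B_2$ ($B_1$ on top). The switch braid quiver $\mathcal{SQ}_X(B)$ is the directed graph with vertex set $X^n$ and with a directed edge from $\overline{x}$ to $\overline{y}$ if and only if $\varphi_B(\overline{x})=\overline{y}$. For finite $X$ this quiver is a disjoint union of directed cycles (since $\varphi_B$ is a bijection); for a vertex $v$, $\mathcal{L}(v)$ denotes the length of the directed cycle containing $v$ (a loop has length $1$). The switch braid quiver polynomial is $\Phi_X^{C}(B)=\sum_{v\in X^n}u^{\mathcal{L}(v)}\in\mathbb{Z}[u]$, summed over the vertices $v$ of $\mathcal{SQ}_X(B)$. *)

(* Defs.v *)
From Stdlib Require Import Relation_Operators.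
From mathcomp Require Import all_boot all_order all_algebra.

Set Implicit Arguments.
Unset Strict Implicit.
Unset Printing Implicit Defensive.

Section YangBaxter.
Variables (X : Type) (rho : X * X -> X * X).

Definition rho_id (t : X * X * X) : X * X * X :=
  let: (x, y, z) := t in let: (x', y') := rho (x, y) in (x', y', z).

Definition id_rho (t : X * X * X) : X * X * X :=
  let: (x, y, z) := t in let: (y', z') := rho (y, z) in (x, y', z').

Definition yang_baxter : Prop :=
  rho_id \o id_rho \o rho_id =1 id_rho \o rho_id \o id_rho.

End YangBaxter.

Record switch (X : Type) := Switch {
  rho : X * X -> X * X;
  rho_inv : X * X -> X * X;
  rhoK : cancel rho rho_inv;
  rho_invK : cancel rho_inv rho;
  rho_ybe : yang_baxter rho
}.

(* The strand positions are 0, ..., n.-1, so the crossing (i, e) involves the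
   strands at positions i and i.+1; the sign e is true for a positive
   crossing. *)
Definition crossing (n : nat) : Type := ('I_n.-1 * bool)%type.

(* Read from top to bottom. *)
Definition braid_word (n : nat) : Type := seq (crossing n).

Section BraidMoves.
Variable n : nat.
Implicit Types (U V : braid_word n) (i j : 'I_n.-1) (a b c e : bool).

Inductive planar_isotopy : braid_word n -> braid_word n -> Prop :=
| FarCommutation U V i j a b : (i.+2 <= j) || (j.+2 <= i) ->
    planar_isotopy (U ++ [:: (i, a); (j, b)] ++ V)
                   (U ++ [:: (j, b); (i, a)] ++ V).

(* Insertions and the reverse Reidemeister III moves come from the symmetric
   closure in braid_equiv. In a Reidemeister III move each pair of strands keeps
   the sign of its crossing while the order of the three crossings is reversed.
   The sign condition excludes exactly a = c = ~~ b: there no strand lies above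
   the other two, so no move is possible. *)
Inductive reidemeister_move : braid_word n -> braid_word n -> Prop :=
| ReidemeisterII U V i e :
    reidemeister_move (U ++ [:: (i, e); (i, ~~ e)] ++ V) (U ++ V)
| ReidemeisterIII U V i j a b c : j = i.+1 :> nat -> (a == b) || (b == c) ->
    reidemeister_move (U ++ [:: (i, a); (j, b); (i, c)] ++ V)
                      (U ++ [:: (j, c); (i, b); (j, a)] ++ V).

Definition braid_equiv : braid_word n -> braid_word n -> Prop :=
  clos_refl_sym_trans (braid_word n)
    (fun B B' => planar_isotopy B B' \/ reidemeister_move B B').

End BraidMoves.

Section Coloring.
Variables (n : nat) (X : Type) (S : switch X).

Fact left_pos_subproof (i : 'I_n.-1) : i < n.
Proof. exact: leq_trans (ltn_ord i) (leq_pred n). Qed.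

Fact right_pos_subproof (i : 'I_n.-1) : i.+1 < n.
Proof. by rewrite -ltn_predRL. Qed.

Definition left_pos (i : 'I_n.-1) : 'I_n := Ordinal (left_pos_subproof i).
Definition right_pos (i : 'I_n.-1) : 'I_n := Ordinal (right_pos_subproof i).

Definition phi_crossing (x : X ^ n) (s : crossing n) : X ^ n :=
  let: (i, e) := s in
  let: (y, z) :=
    (if e then rho S else rho_inv S) (x (left_pos i), x (right_pos i)) in
  [ffun k => if k == left_pos i then y
             else if k == right_pos i then z else x k].

Definition phi (B : braid_word n) (x : X ^ n) : X ^ n := foldl phi_crossing x B.

End Coloring.

Definition switch_quiver (n : nat) (X : finType) (S : switch X)
  (B : braid_word n) : rel (X ^ n) := fun x y => phi S B x == y.

(* The length of a directed cycle of the graph e without repeated vertices and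
   containing v. The default value 0 is taken only when v lies on no cycle,
   and all these cycles have the same length in a switch quiver: see
   cycle_lengthP below. *)
Definition cycle_length (V : finType) (e : rel V) (v : V) : nat :=
  if [pick k : 'I_#|V|.+1 | [exists c : k.-tuple V, ucycleb e c && (v \in c)]]
    is Some k then k else 0.

Definition quiver_polynomial (n : nat) (X : finType) (S : switch X)
  (B : braid_word n) : {poly int} :=
  (\sum_(v : X ^ n) 'X^(cycle_length (switch_quiver S B) v))%R.

Fact phi_inj (n : nat) (X : finType) (S : switch X) (B : braid_word n) :
  injective (phi S B).
Proof.
elim: B => [|[i e] B IHB] x y //= /IHB.
have kl : right_pos i == left_pos i = false by rewrite -val_eqE /= gtn_eqF.
have r_inj : injective (if e then rho S else rho_inv S).
  by case: e; [exact: can_inj (rhoK S) | exact: can_inj (rho_invK S)].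
rewrite /phi_crossing.
case Ex: (_ (x _, x _)) => [x1 x2]; case Ey: (_ (y _, y _)) => [y1 y2] E.
have := congr1 (fun f : X ^ n => f (left_pos i)) E.
have := congr1 (fun f : X ^ n => f (right_pos i)) E.
rewrite /= !ffunE !eqxx kl => e2 e1; move: Ex; rewrite e1 e2 -Ey => /r_inj[xl xr].
apply/ffunP=> k; have := congr1 (fun f : X ^ n => f k) E; rewrite /= !ffunE.
by case: eqP => [->|_] //; case: eqP => [->|].
Qed.

(* The directed cycle through v is unique up to rotation; cycle_length is its
   length. *)
Fact cycle_lengthP (n : nat) (X : finType) (S : switch X) (B : braid_word n)
    (v : X ^ n) :
  (exists2 c, ucycle (switch_quiver S B) c & v \in c) /\
  forall c, ucycle (switch_quiver S B) c -> v \in c ->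
    cycle_length (switch_quiver S B) v = size c.
Proof.
set f := phi S B; have f_inj : injective f := @phi_inj _ _ S B.
have sz c : ucycle (switch_quiver S B) c -> v \in c -> size c = order f v.
  move=> /andP[cyc_c uniq_c] vc.
  by rewrite (@order_cycle _ f c cyc_c uniq_c v vc).
have [co uo vo] : [/\ cycle (switch_quiver S B) (orbit f v),
    uniq (orbit f v) & v \in orbit f v].
  by split; [exact: cycle_orbit | exact: orbit_uniq | rewrite -fconnect_orbit].
have ucy : ucycle (switch_quiver S B) (orbit f v) by apply/andP.
split=> [|c cyc_c vc]; first by exists (orbit f v).
rewrite (sz c cyc_c vc) /cycle_length; case: pickP => [k /existsP[t /andP[ct vt]]|].
  by rewrite -(sz t ct vt) size_tuple.
have lt_k : order f v < #|{: X ^ n}|.+1 by rewrite ltnS max_card.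
move=> /(_ (Ordinal lt_k))/existsP[].
have tP : size (orbit f v) == order f v by rewrite size_orbit.
by exists (Tuple tP); apply/andP; split; [exact: ucy | exact: vo].
Qed.

(* Main.v *)
Require Import Defs.
From mathcomp Require Import all_boot all_order all_algebra.
From mathcomp Require Import zify.

(** The quiver of [B] is the graph of the coloring map [phi S B], so it is enough
    that this map does not change under a braid move. Since [phi] turns
    concatenation into composition, only the few crossings that the move alters
    matter. Each acts on two coordinates through the switch or its inverse
    ([act_pair]), and the three kinds of moves become three facts about such
    operators: operators on disjoint pairs commute ([act_pair_comm]), the two
    signs are inverse to each other ([act_pairK]), and the Yang-Baxter equation
    on three coordinates is the positive Reidemeister III move
    ([act_pair_braid]). The other signs of Reidemeister III then follow by the
    cancellations valid in any group where [s t s = t s t]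
    ([signed_braid_relation]). *)

Set Implicit Arguments.
Unset Strict Implicit.
Unset Printing Implicit Defensive.

(** * Operators on a pair of coordinates *)

Section ActPair.
Variables (I : finType) (X : Type).
Implicit Types (r : X * X -> X * X) (x : {ffun I -> X}) (p q s t : I).

(** Positions are taken in an arbitrary finite type: the braid relations only
    depend on which positions coincide, not on their order. *)
Definition act_pair r p q x : {ffun I -> X} :=
  [ffun k => if k == p then (r (x p, x q)).1
             else if k == q then (r (x p, x q)).2 else x k].

Lemma act_pairK r r' p q :
  p != q -> cancel r r' -> cancel (act_pair r p q) (act_pair r' p q).
Proof.
move=> pq rK x; have qp : (q == p) = false by rewrite eq_sym (negPf pq).
apply/ffunP=> k; rewrite !ffunE !eqxx qp.
by rewrite -surjective_pairing rK /=; do 2?[case: eqP => [-> //|_]].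
Qed.

Lemma act_pair_comm r r' p q s t x :
    p != s -> p != t -> q != s -> q != t ->
  act_pair r p q (act_pair r' s t x) = act_pair r' s t (act_pair r p q x).
Proof.
move=> ps pt qs qt; apply/ffunP=> k; rewrite !ffunE.
rewrite !(eq_sym s) !(eq_sym t) (negPf ps) (negPf pt) (negPf qs) (negPf qt).
case: (eqVneq k p) => [->|_]; first by rewrite (negPf ps) (negPf pt).
by case: (eqVneq k q) => [->|//]; rewrite (negPf qs) (negPf qt).
Qed.

Lemma act_pair_braid r p q s x :
    yang_baxter r -> p != q -> q != s -> p != s ->
  act_pair r p q (act_pair r q s (act_pair r p q x)) =
  act_pair r q s (act_pair r p q (act_pair r q s x)).
Proof.
move=> ybe pq qs ps; have := ybe (x p, x q, x s); rewrite /= /rho_id /id_rho.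
case E1: (r (x p, x q)) => [y1 y2]; case E2: (r (y2, x s)) => [y3 y4].
case E3: (r (y1, y3)) => [y5 y6]; case F1: (r (x q, x s)) => [z1 z2].
case F2: (r (x p, z1)) => [z3 z4]; case F3: (r (z4, z2)) => [z5 z6].
case=> e5 e6 e4; apply/ffunP=> k.
have [qp sq sp] : [/\ (q == p) = false, (s == q) = false & (s == p) = false].
  by rewrite !(eq_sym s) (eq_sym q p) (negPf pq) (negPf qs) (negPf ps).
(* Both sides compute the three coordinates of the Yang-Baxter equation. *)
pose D := (eqxx, negPf pq, negPf qs, negPf ps, qp, sq, sp).
rewrite !ffunE !D E1 /= E2 /= E3 F1 /= F2 /= F3 /= e5 e6 e4.
case: (eqVneq k p) => [->|_]; first by rewrite !D.
by case: (k == q); case: (k == s).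
Qed.

End ActPair.

(** * Signed braid relations *)

(** Let [f true], [g true] be bijections with inverses [f false], [g false]. The
    positive braid relation gives all the sign variants for which
    Reidemeister III is possible: in each case one takes [x] to be the image of
    some point under those positive maps that cancel the negative ones applied
    first, and the positive relation at an intermediate point cancels the rest. *)
Lemma signed_braid_relation (T : Type) (f g : bool -> T -> T) (a b c : bool) :
    (forall e, cancel (f e) (f (~~ e))) -> (forall e, cancel (g e) (g (~~ e))) ->
    (forall x, f true (g true (f true x)) = g true (f true (g true x))) ->
    (a == b) || (b == c) ->
  forall x, f c (g b (f a x)) = g a (f b (g c x)).
Proof.
move=> fK gK fgf.
have [f1 g1] := (fK true, gK true); rewrite /= in f1 g1.
have onto (h : bool -> T -> T) : (forall e, cancel (h e) (h (~~ e))) ->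
    forall x, exists y, x = h true y.
  by move=> hK x; exists (h false x); rewrite (hK false).
have [fS gS] := (onto f fK, onto g gK).
case: a b c => [] [] [] //= _ x.
- by have [y ->] := gS x; rewrite -fgf f1 g1.
- by have [y ->] := gS x; have [z ->] := fS y; rewrite g1 f1 fgf g1 f1.
- by have [y ->] := fS x; rewrite f1 fgf g1.
- by have [y ->] := fS x; have [z ->] := gS y; rewrite f1 g1 -fgf f1 g1.
have [y ->] := fS x; have [z ->] := gS y; have [w ->] := fS z.
by rewrite f1 g1 f1 fgf !(f1, g1).
Qed.

(** * Invariance of the coloring map *)

Section ColoringInvariance.
Variables (n : nat) (X : Type) (S : switch X).
Implicit Types (B U V W : braid_word n) (i j : 'I_n.-1).
Implicit Types (a b c e : bool) (x : X ^ n).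

Lemma phi_cat U V x : phi S (U ++ V) x = phi S V (phi S U x).
Proof. exact: foldl_cat. Qed.

Lemma phi_local U V W W' :
  phi S W =1 phi S W' -> phi S (U ++ W ++ V) =1 phi S (U ++ W' ++ V).
Proof. by move=> WW' x; rewrite !phi_cat WW'. Qed.

Lemma phi_crossingE x i e :
  phi_crossing S x (i, e) =
  act_pair (if e then rho S else rho_inv S) (left_pos i) (right_pos i) x.
Proof.
rewrite /phi_crossing; case E: (_ (x _, x _)) => [y z].
by apply/ffunP=> k; rewrite !ffunE E.
Qed.

(* Keeps simplification from unfolding a crossing of known position and sign, so
   that phi_crossingE still applies after phi is unrolled along a word. *)
Local Arguments phi_crossing : simpl never.

Lemma left_right_neq i : left_pos i != right_pos i.
Proof. by rewrite -val_eqE /= ltn_eqF. Qed.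

Lemma phi_crossingK i e :
  cancel (phi_crossing S ^~ (i, e)) (phi_crossing S ^~ (i, ~~ e)).
Proof.
move=> x; rewrite !phi_crossingE act_pairK ?left_right_neq //.
by case: e; [exact: rhoK | exact: rho_invK].
Qed.

Lemma phi_far_commutation i j a b : (i.+2 <= j) || (j.+2 <= i) ->
  phi S [:: (i, a); (j, b)] =1 phi S [:: (j, b); (i, a)].
Proof.
move=> far x; rewrite /phi /= !phi_crossingE.
by apply: act_pair_comm; rewrite -val_eqE /=; lia.
Qed.

Lemma phi_reidemeister3 i j a b c : j = i.+1 :> nat -> (a == b) || (b == c) ->
  phi S [:: (i, a); (j, b); (i, c)] =1 phi S [:: (j, c); (i, b); (j, a)].
Proof.
move=> ji abc x; rewrite /phi /=.
pose s k e (y : X ^ n) := phi_crossing S y (k, e).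
rewrite -[LHS]/(s i c (s j b (s i a x))) -[RHS]/(s j a (s i b (s j c x))).
apply: signed_braid_relation abc x => [e|e|y]; try exact: phi_crossingK.
(* The middle strand position is shared by the two crossings. *)
have lj : left_pos j = right_pos i by apply: val_inj.
rewrite /s !phi_crossingE lj.
apply: act_pair_braid; first exact: rho_ybe.
- exact: left_right_neq.
- by rewrite -lj left_right_neq.
- by rewrite -val_eqE /= ji ltn_eqF.
Qed.

Lemma phi_braid_equiv B B' : braid_equiv B B' -> phi S B =1 phi S B'.
Proof.
elim=> {B B'} [B B' [] []|B|B B' _ IH|B B1 B' _ IH1 _ IH2] //.
- by move=> U V i j a b far; apply: phi_local; exact: phi_far_commutation.
- by move=> U V i e x; rewrite !phi_cat /= phi_crossingK.
- by move=> U V i j a b c ji abc; apply: phi_local; exact: phi_reidemeister3.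
- by move=> x; rewrite IH1 IH2.
Qed.

End ColoringInvariance.

(** * Invariance of the quiver polynomial *)

Lemma eq_cycle_length (V : finType) (e e' : rel V) :
  e =2 e' -> cycle_length e =1 cycle_length e'.
Proof.
move=> ee' v; rewrite /cycle_length.
rewrite (@eq_pick _ _ (fun k : 'I_#|V|.+1 =>
  [exists c : k.-tuple V, ucycleb e' c && (v \in c)])) // => k.
by apply: eq_existsb => c; rewrite /ucycleb (eq_cycle ee').
Qed.

Theorem corollary11 (n : nat) (hn : (0 < n)%N) (X : finType) (S : switch X)
    (B B' : braid_word n) :
  braid_equiv B B' -> quiver_polynomial S B = quiver_polynomial S B'.
Proof.
move=> BB'; apply: eq_bigr => v _; congr ('X^_)%R.
by apply: eq_cycle_length => x y; rewrite /switch_quiver (phi_braid_equiv S BB').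
Qed.
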